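(* Assume $A_n$ satisfies (C1), the mean field condition $\lim_{n\to\infty}\frac1n\sum_{i,j=1}^nA_n(i,j)^2=0$, and the asymptotic regularity condition $$\lim_{n\to\infty}\frac1n\sum_{i=1}^n\big(\mathcal R_n(i)-\overline{\mathcal R}_n\big)^2=0.$$ Then for every $(\beta,B)\in\Theta$, $T_n(\mathbf X)\to0$ in $\mathbb P_{n,\beta,B}$-probability.
   Context: For each $n$, $A_n$ is a known symmetric $n\times n$ matrix with non-negative entries and zero diagonal. The Ising model is $\mathbb P_{n,\beta,B}(\mathbf X=\mathbf x)=Z_n(\beta,B)^{-1}\exp(\frac{\beta}{2}\mathbf x^\top A_n\mathbf x+B\sum_i x_i)$ on $\{-1,1\}^n$. (C1): there is a constant $\gamma<\infty$ with $\max_{i}\sum_{j}A_n(i,j)\le\gamma$ for all $n$. $\Theta=\{(\beta,B):\beta>0,B\ne0\}$. $\mathcal R_n(i)=\sum_{j}A_n(i,j)$, $\overline{\mathcal R}_n=\frac1n\sum_i\mathcal R_n(i)$. $m_i(\mathbf x)=\sum_jA_n(i,j)x_j$, $\bar m(\mathbf x)=\frac1n\sum_i m_i(\mathbf x)$, $T_n(\mathbf x)=\frac1n\sum_i(m_i(\mathbf x)-\bar m(\mathbf x))^2$. *)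

(* Defs.v *)
From Stdlib Require Import Reals Lra.
Open Scope R_scope.

(* Interaction matrices: A n i j is the (i,j) entry of A_n, indices 0..n-1. *)
Definition matseq := nat -> nat -> nat -> R.

Fixpoint fsum (n : nat) (f : nat -> R) : R :=
  match n with
  | O => 0
  | S m => fsum m f + f m
  end.

(* spin configurations: x : nat -> R; only coordinates 0..n-1 matter *)
Definition upd (x : nat -> R) (m : nat) (s : R) : nat -> R :=
  fun i => if Nat.eqb i m then s else x i.

(* sum of F over all 2^n configurations x in {-1,1}^n
   (coordinates 0..n-1 take values in {-1,1}; others are fixed to 1) *)
Fixpoint sum_cfg (n : nat) (F : (nat -> R) -> R) : R :=
  match n with
  | O => F (fun _ => 1)
  | S m => sum_cfg m (fun x => F (upd x m 1) + F (upd x m (-1)))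
  end.

Definition ising_weight (A : matseq) (n : nat) (beta B : R) (x : nat -> R) : R :=
  exp (beta / 2 * fsum n (fun i => fsum n (fun j => A n i j * x i * x j))
       + B * fsum n (fun i => x i)).

Definition Zn (A : matseq) (n : nat) (beta B : R) : R :=
  sum_cfg n (ising_weight A n beta B).

Definition ising_prob (A : matseq) (n : nat) (beta B : R)
  (E : (nat -> R) -> Prop) (Edec : forall x, {E x} + {~ E x}) : R :=
  sum_cfg n (fun x => if Edec x then ising_weight A n beta B x else 0)
  / Zn A n beta B.

Definition rowsum (A : matseq) (n i : nat) : R := fsum n (fun j => A n i j).
Definition rowsum_avg (A : matseq) (n : nat) : R := / INR n * fsum n (rowsum A n).

Definition mloc (A : matseq) (n i : nat) (x : nat -> R) : R :=
  fsum n (fun j => A n i j * x j).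
Definition mbar (A : matseq) (n : nat) (x : nat -> R) : R :=
  / INR n * fsum n (fun i => mloc A n i x).
Definition Tn (A : matseq) (n : nat) (x : nat -> R) : R :=
  / INR n * fsum n (fun i => (mloc A n i x - mbar A n x) ^ 2).

Definition prob_Tn_gt (A : matseq) (n : nat) (beta B eps : R) : R :=
  ising_prob A n beta B (fun x => eps < Rabs (Tn A n x))
    (fun x => Rlt_dec eps (Rabs (Tn A n x))).

(* Main.v *)
(* By the global spin flip one may take B > 0. Write E for the Ising expectation,
   u_j = E x_j, mu_i = E m_i = sum_j A_ij u_j and f(s) = tanh(beta s + B).

   The GHS inequality makes u_i concave in the field B >= 0, so the i-th row sum of the
   covariance matrix, which is the derivative of u_i, is at most 1/B. As covariances are
   nonnegative, the covariance matrix then has operator norm at most 1/B, whence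
   sum_i Var(m_i) <= (1/B) sum_ij A_ij^2 = o(n). Therefore u_i = E f(m_i) is close to
   f(mu_i), that is, mu nearly solves mu = A f(mu), and mu >= 0 by Griffiths' inequality.
   Let t >= 0 solve t = Rbar f(t). Concavity of tanh makes Rbar f a strict contraction
   towards t on [0, oo), and since row sums are nearly Rbar this forces
   sum_i |mu_i - t| = o(n). Hence E T_n -> 0, and Markov's inequality concludes.

   Both correlation inequalities come from four independent replicas: in suitable
   orthogonal coordinates the joint weight is the exponential of a polynomial with
   nonnegative coefficients, and every monomial has a nonnegative sum over spins. *)
Require Import Defs.
From Stdlib Require Import Reals Factorial Lra Lia FunctionalExtensionality.
Open Scope R_scope.

(** * Finite sums *)

Lemma fsum_ext n f g : (forall i, (i < n)%nat -> f i = g i) -> fsum n f = fsum n g.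
Proof.
  induction n as [|n IH]; simpl; intros H; auto.
  rewrite IH, H by (intros; try apply H; lia); auto.
Qed.

Lemma fsum_plus n f g : fsum n (fun i => f i + g i) = fsum n f + fsum n g.
Proof. induction n as [|n IH]; simpl; [ring|rewrite IH; ring]. Qed.

Lemma fsum_scal n c f : fsum n (fun i => c * f i) = c * fsum n f.
Proof. induction n as [|n IH]; simpl; [ring|rewrite IH; ring]. Qed.

Lemma fsum_minus n f g : fsum n (fun i => f i - g i) = fsum n f - fsum n g.
Proof. induction n as [|n IH]; simpl; [ring|rewrite IH; ring]. Qed.

Lemma fsum_const n c : fsum n (fun _ => c) = INR n * c.
Proof. induction n as [|n IH]; simpl fsum; [simpl; ring|rewrite IH, S_INR; ring]. Qed.

Lemma fsum_le n f g : (forall i, (i < n)%nat -> f i <= g i) -> fsum n f <= fsum n g.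
Proof.
  induction n as [|n IH]; simpl; intros H; [lra|].
  apply Rplus_le_compat; auto.
Qed.

Lemma fsum_ge0 n f : (forall i, (i < n)%nat -> 0 <= f i) -> 0 <= fsum n f.
Proof.
  intros H. replace 0 with (fsum n (fun _ => 0)) by (rewrite fsum_const; ring).
  now apply fsum_le.
Qed.

Lemma fsum_swap m n f :
  fsum m (fun i => fsum n (fun j => f i j)) = fsum n (fun j => fsum m (fun i => f i j)).
Proof.
  induction m as [|m IH]; simpl.
  - rewrite fsum_const; ring.
  - now rewrite IH, <- fsum_plus.
Qed.

Lemma fsum_mult m n f g :
  fsum m f * fsum n g = fsum m (fun i => fsum n (fun j => f i * g j)).
Proof.
  rewrite Rmult_comm, <- fsum_scal; apply fsum_ext; intros i _.
  rewrite fsum_scal; ring.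
Qed.

Lemma fsum_abs n f : Rabs (fsum n f) <= fsum n (fun i => Rabs (f i)).
Proof.
  induction n as [|n IH]; simpl; [rewrite Rabs_R0; lra|].
  eapply Rle_trans; [apply Rabs_triang|lra].
Qed.

(** * Sums over spin configurations *)

Definition spin (x : nat -> R) : Prop := forall i, x i = 1 \/ x i = -1.

Lemma spin_upd x m s : spin x -> s = 1 \/ s = -1 -> spin (upd x m s).
Proof. intros Hx Hs i; unfold upd; destruct (Nat.eqb i m); auto. Qed.

Lemma sum_cfg_ext n F G : (forall x, spin x -> F x = G x) -> sum_cfg n F = sum_cfg n G.
Proof.
  revert F G; induction n as [|n IH]; simpl; intros F G H.
  - apply H; intros i; auto.
  - apply IH; intros x Hx; rewrite !H; auto using spin_upd.
Qed.

Lemma sum_cfg_plus n F G :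
  sum_cfg n (fun x => F x + G x) = sum_cfg n F + sum_cfg n G.
Proof.
  revert F G; induction n as [|n IH]; simpl; intros F G; auto.
  rewrite <- IH; apply sum_cfg_ext; intros; ring.
Qed.

Lemma sum_cfg_scal n c F : sum_cfg n (fun x => c * F x) = c * sum_cfg n F.
Proof.
  revert F; induction n as [|n IH]; simpl; intros F; auto.
  rewrite <- IH; apply sum_cfg_ext; intros; ring.
Qed.

Lemma sum_cfg_le n F G : (forall x, spin x -> F x <= G x) -> sum_cfg n F <= sum_cfg n G.
Proof.
  revert F G; induction n as [|n IH]; simpl; intros F G H.
  - apply H; intros i; auto.
  - apply IH; intros x Hx; apply Rplus_le_compat; apply H; auto using spin_upd.
Qed.

Lemma sum_cfg_ge0 n F : (forall x, spin x -> 0 <= F x) -> 0 <= sum_cfg n F.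
Proof.
  intros H. replace 0 with (sum_cfg n (fun _ => 0 * 0)) by (rewrite sum_cfg_scal; ring).
  apply sum_cfg_le; intros; rewrite Rmult_0_l; auto.
Qed.

Lemma sum_cfg_gt0 n F : (forall x, 0 < F x) -> 0 < sum_cfg n F.
Proof.
  revert F; induction n as [|n IH]; simpl; intros F H; auto.
  apply IH; intros x; apply Rplus_lt_0_compat; auto.
Qed.

Lemma sum_cfg_cv n (F : nat -> (nat -> R) -> R) G :
  (forall x, Un_cv (fun N => F N x) (G x)) ->
  Un_cv (fun N => sum_cfg n (F N)) (sum_cfg n G).
Proof.
  revert F G; induction n as [|n IH]; simpl; intros F G H; auto.
  apply (IH (fun N x => F N (upd x n 1) + F N (upd x n (-1)))).
  intros x; apply (CV_plus (fun N => F N (upd x n 1)) (fun N => F N (upd x n (-1)))); auto.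
Qed.

Lemma sum_cfg_derivable n (F : R -> (nat -> R) -> R) (F' : (nat -> R) -> R) b :
  (forall x, derivable_pt_lim (fun c => F c x) b (F' x)) ->
  derivable_pt_lim (fun c => sum_cfg n (F c)) b (sum_cfg n F').
Proof.
  revert F F'; induction n as [|n IH]; simpl; intros F F' H; auto.
  apply (IH (fun c x => F c (upd x n 1) + F c (upd x n (-1)))).
  intros x; apply (derivable_pt_lim_plus (fun c => F c (upd x n 1))
    (fun c => F c (upd x n (-1)))); auto.
Qed.

(** * Products over sites and changes of single spins *)

Fixpoint fprod (n : nat) (f : nat -> R) : R :=
  match n with O => 1 | S m => fprod m f * f m end.

Lemma fprod_ext n f g : (forall i, (i < n)%nat -> f i = g i) -> fprod n f = fprod n g.
Proof.
  induction n as [|n IH]; simpl; intros H; auto.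
  rewrite IH, H by (intros; try apply H; lia); auto.
Qed.

Lemma fprod_mult n f g : fprod n (fun i => f i * g i) = fprod n f * fprod n g.
Proof. induction n as [|n IH]; simpl; [ring|rewrite IH; ring]. Qed.

Lemma fprod_ge0 n f : (forall i, (i < n)%nat -> 0 <= f i) -> 0 <= fprod n f.
Proof.
  induction n as [|n IH]; simpl; intros H; [lra|].
  apply Rmult_le_pos; auto.
Qed.

Lemma upd_same x m s : upd x m s m = s.
Proof. unfold upd; now rewrite Nat.eqb_refl. Qed.

Lemma upd_other x m s i : i <> m -> upd x m s i = x i.
Proof. intros H; unfold upd; destruct (Nat.eqb_spec i m); tauto. Qed.

Lemma sum_cfg_fprod n (g : nat -> R -> R) :
  sum_cfg n (fun x => fprod n (fun i => g i (x i))) =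
  fprod n (fun i => g i 1 + g i (-1)).
Proof.
  induction n as [|n IH]; simpl; auto.
  rewrite <- IH, Rmult_comm, <- sum_cfg_scal.
  apply sum_cfg_ext; intros x _; rewrite !upd_same.
  rewrite (fprod_ext n _ (fun i => g i (x i))) by (intros i Hi; now rewrite upd_other by lia).
  rewrite (fprod_ext n (fun i => g i (upd x n (-1) i)) (fun i => g i (x i)))
    by (intros i Hi; now rewrite upd_other by lia).
  ring.
Qed.

Lemma upd_upd x m s t : upd (upd x m s) m t = upd x m t.
Proof.
  apply functional_extensionality; intros i; unfold upd; now destruct (Nat.eqb i m).
Qed.

Lemma upd_comm x k m s t : k <> m -> upd (upd x k s) m t = upd (upd x m t) k s.
Proof.
  intros H; apply functional_extensionality; intros i; unfold upd.
  destruct (Nat.eqb_spec i k), (Nat.eqb_spec i m); subst; tauto.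
Qed.

(** Flipping one summed spin permutes the configurations; [mean_spin] uses this to pair each
    configuration with its flip. *)
Lemma sum_cfg_flip n j F : (j < n)%nat ->
  sum_cfg n F = sum_cfg n (fun x => F (upd x j (- x j))).
Proof.
  revert F; induction n as [|n IH]; simpl; intros F Hj; [lia|].
  destruct (Nat.eq_dec j n) as [->|Hn].
  - apply sum_cfg_ext; intros x _; rewrite !upd_same, !upd_upd.
    replace (- (1)) with (-1) by ring; replace (- -1) with 1 by ring; ring.
  - rewrite IH by lia; apply sum_cfg_ext; intros x _.
    rewrite !(upd_other _ n _ j) by auto.
    now rewrite !(upd_comm _ n j) by auto.
Qed.

(** Locality of [F] matters here: [sum_cfg] fixes the coordinates from [n] on to 1, while the
    negated configuration has -1 there. *)
Lemma sum_cfg_neg n F :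
  (forall x y, (forall i, (i < n)%nat -> x i = y i) -> F x = F y) ->
  sum_cfg n F = sum_cfg n (fun x => F (fun i => - x i)).
Proof.
  revert F; induction n as [|n IH]; simpl; intros F HF.
  - apply HF; intros; lia.
  - rewrite IH.
    + apply sum_cfg_ext; intros x _; rewrite Rplus_comm; f_equal; f_equal;
        apply functional_extensionality; intros i; unfold upd;
        destruct (Nat.eqb i n); lra.
    + intros x y H; f_equal; apply HF; intros i Hi; unfold upd;
        destruct (Nat.eqb_spec i n); auto; apply H; lia.
Qed.

(** * The hyperbolic tangent *)

Lemma cosh_gt0 x : 0 < cosh x.
Proof. unfold cosh; generalize (exp_pos x) (exp_pos (- x)); lra. Qed.

Lemma tanh_0 : tanh 0 = 0.
Proof. unfold tanh; rewrite sinh_0; unfold Rdiv; ring. Qed.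

Lemma tanh_sq_le1 x : tanh x * tanh x <= 1.
Proof.
  assert (Hc := cosh_gt0 x).
  assert (H : 0 <= 1 - tanh x * tanh x); [|lra].
  replace (1 - tanh x * tanh x) with (/ (cosh x * cosh x)).
  - left; apply Rinv_0_lt_compat; nra.
  - assert (E : cosh x * cosh x - sinh x * sinh x = 1).
    { unfold cosh, sinh. assert (E : exp x * exp (- x) = 1)
        by (rewrite <- exp_plus, Rplus_opp_r; apply exp_0).
      lra. }
    unfold tanh.
    replace (1 - sinh x / cosh x * (sinh x / cosh x))
      with ((cosh x * cosh x - sinh x * sinh x) / (cosh x * cosh x)) by (field; lra).
    rewrite E; field; lra.
Qed.

Lemma tanh_bound x : -1 <= tanh x <= 1.
Proof. generalize (tanh_sq_le1 x); split; nra. Qed.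

Lemma derivable_pt_lim_tanh x : derivable_pt_lim tanh x (1 - tanh x * tanh x).
Proof.
  assert (Hc := cosh_gt0 x).
  replace (1 - tanh x * tanh x) with
    ((cosh x * cosh x - sinh x * sinh x) / Rsqr (cosh x)).
  - apply (derivable_pt_lim_div sinh cosh); [apply derivable_pt_lim_sinh|
      apply derivable_pt_lim_cosh|lra].
  - unfold tanh, Rsqr; field; lra.
Qed.

Lemma tanh_mvt a b : a < b ->
  exists c, tanh b - tanh a = (1 - tanh c * tanh c) * (b - a) /\ a < c < b.
Proof.
  intros H; apply (MVT_cor2 tanh (fun c => 1 - tanh c * tanh c)); auto.
  intros; apply derivable_pt_lim_tanh.
Qed.

Lemma tanh_le a b : a <= b -> tanh a <= tanh b.
Proof.
  intros [H| ->]; [|lra].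
  destruct (tanh_mvt a b H) as (c & Hc & _); generalize (tanh_sq_le1 c); nra.
Qed.

Lemma tanh_ge0 x : 0 <= x -> 0 <= tanh x.
Proof. intros H; rewrite <- tanh_0; now apply tanh_le. Qed.

Lemma tanh_lipschitz a b : Rabs (tanh b - tanh a) <= Rabs (b - a).
Proof.
  assert (W : forall a b, a < b -> Rabs (tanh b - tanh a) <= Rabs (b - a)).
  { clear; intros a b H; rewrite !Rabs_pos_eq; [|lra|generalize (tanh_le a b); lra].
    destruct (tanh_mvt a b H) as (c & -> & _).
    generalize (tanh_sq_le1 c) (Rle_0_sqr (tanh c)); unfold Rsqr; nra. }
  destruct (Rtotal_order a b) as [H|[->|H]]; auto.
  - rewrite !Rminus_diag, Rabs_R0; lra.
  - rewrite (Rabs_minus_sym (tanh b)), (Rabs_minus_sym b); auto.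
Qed.

(* Concavity of [tanh] on the positive half-line: chords from the origin get flatter. *)
Lemma tanh_chord a b : 0 < a -> a <= b -> a * tanh b <= b * tanh a.
Proof.
  intros Ha [Hab| ->]; [|lra].
  destruct (tanh_mvt 0 a Ha) as (c & Hc & Hc1); rewrite tanh_0 in Hc.
  destruct (tanh_mvt a b Hab) as (d & Hd & Hd1).
  assert (0 <= tanh c) by (apply tanh_ge0; lra).
  assert (tanh c <= tanh d) by (apply tanh_le; lra).
  assert (0 <= (tanh d * tanh d - tanh c * tanh c) * (a * (b - a))).
  { apply Rmult_le_pos; nra. }
  nra.
Qed.

(* If [t = r * tanh (beta t + b)], the map [x -> r * tanh (beta x + b)] contracts
   towards [t] on [0, oo), although it need not be a contraction. *)
Lemma mean_field_contraction beta b r g t x :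
  0 < beta -> 0 < b -> 0 <= r -> 0 <= t <= g -> 0 <= x ->
  t = r * tanh (beta * t + b) ->
  r * Rabs (tanh (beta * x + b) - tanh (beta * t + b))
    <= (1 - b / (beta * g + b)) * Rabs (x - t).
Proof.
  intros Hbeta Hb Hr Ht Hx Et.
  set (yt := beta * t + b) in *. set (yx := beta * x + b).
  assert (Hyt : 0 < yt) by (unfold yt; nra).
  assert (Hyx : 0 < yx) by (unfold yx; nra).
  (* By concavity the chord joining [yt] and [yx] is no steeper than the chord from 0 to [yt];
     either order of the two points reduces to [tanh_chord]. *)
  assert (K : yt * Rabs (tanh yx - tanh yt) <= tanh yt * Rabs (yx - yt)).
  { destruct (Rle_lt_dec yt yx) as [H|H].
    - rewrite !Rabs_pos_eq; [|lra|generalize (tanh_le yt yx); lra].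
      generalize (tanh_chord yt yx Hyt H); nra.
    - rewrite !(Rabs_left1 (_ - _)); [|lra|generalize (tanh_le yx yt); lra].
      generalize (tanh_chord yx yt Hyx (Rlt_le _ _ H)); nra. }
  replace (yx - yt) with (beta * (x - t)) in K by (unfold yx, yt; ring).
  rewrite Rabs_mult, (Rabs_pos_eq beta) in K by lra.
  set (P := Rabs (x - t)) in *. set (D := Rabs (tanh yx - tanh yt)) in *.
  assert (HP : 0 <= P) by apply Rabs_pos.
  (* Since [r * tanh yt] is [t], the factor is [beta * t / yt = 1 - b / yt]; it is then bounded
     uniformly through [t <= g]. *)
  assert (L : yt * (r * D) <= beta * t * P).
  { assert (r * (yt * D) <= r * (tanh yt * (beta * P))) by (apply Rmult_le_compat_l; auto).
    replace (beta * t * P) with (beta * (r * tanh yt) * P) by now rewrite <- Et.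
    lra. }
  assert (Hg : 0 < beta * g + b) by nra.
  apply Rle_trans with ((1 - b / yt) * P).
  - apply Rmult_le_reg_l with yt; auto.
    replace (yt * ((1 - b / yt) * P)) with ((yt - b) * P) by (field; lra).
    unfold yt at 2; lra.
  - apply Rmult_le_compat_r; auto.
    apply Rplus_le_compat_l, Ropp_le_contravar.
    apply Rmult_le_compat_l; [lra|].
    apply Rinv_le_contravar; unfold yt; nra.
Qed.

(** Intermediate value theorem on [[0, r]]: the values of [tanh] met here lie between 0 and 1, so
    [t - r * tanh (beta * t + b)] is nonpositive at 0 and nonnegative at [r]. *)
Lemma mean_field_fixpoint beta b r : 0 <= r -> 0 <= beta -> 0 <= b ->
  exists t, 0 <= t <= r /\ t = r * tanh (beta * t + b).
Proof.
  intros Hr Hbeta Hb.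
  set (g := fun t => t - r * tanh (beta * t + b)).
  assert (Hg : continuity g).
  { intros t; apply derivable_continuous_pt.
    exists (1 - r * ((1 - tanh (beta * t + b) * tanh (beta * t + b)) * (beta * 1 + 0))).
    apply derivable_pt_lim_minus; [apply derivable_pt_lim_id|].
    apply (derivable_pt_lim_scal (fun t => tanh (beta * t + b))).
    apply (derivable_pt_lim_comp (fun t => beta * t + b) tanh).
    - apply (derivable_pt_lim_plus (fun t => beta * t) (fun _ => b)).
      + apply (derivable_pt_lim_scal (fun t => t)), derivable_pt_lim_id.
      + apply derivable_pt_lim_const.
    - apply derivable_pt_lim_tanh. }
  destruct (IVT_cor g 0 r Hg Hr) as (t & Ht & E).
  - assert (g 0 <= 0).
    { unfold g. assert (0 <= tanh (beta * 0 + b)) by (apply tanh_ge0; lra). nra. }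
    assert (0 <= g r).
    { unfold g. generalize (tanh_bound (beta * r + b)); nra. }
    nra.
  - exists t; split; auto. unfold g in E; lra.
Qed.

(** * Four replicas *)

(* The orthogonal change of variables of Ellis and Monroe. The sign of [rep4] makes
   [rep1 * rep2 * rep3 * rep4] nonnegative on spins. *)
Definition rep1 (p q r s : R) := (p + q + r + s) / 2.
Definition rep2 (p q r s : R) := (p + q - r - s) / 2.
Definition rep3 (p q r s : R) := (p - q + r - s) / 2.
Definition rep4 (p q r s : R) := (- p + q + r - s) / 2.

Definition site_sum (g : R -> R -> R -> R -> R) : R :=
  let g3 p q r := g p q r 1 + g p q r (-1) in
  let g2 p q := g3 p q 1 + g3 p q (-1) in
  let g1 p := g2 p 1 + g2 p (-1) in
  g1 1 + g1 (-1).

Lemma pow_m1_cases a : (-1) ^ a = 1 \/ (-1) ^ a = -1.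
Proof. induction a as [|a [H|H]]; simpl; [left|right|left]; rewrite ?H; ring. Qed.

Lemma pow_0_cases a : 0 ^ a = 1 \/ 0 ^ a = 0.
Proof. destruct a; simpl; [left|right]; ring. Qed.

Lemma pow_m2 a : (-2) ^ a = (-1) ^ a * 2 ^ a.
Proof. rewrite <- Rpow_mult_distr; f_equal; ring. Qed.

(** If the four spins have product 1, one coordinate is 2 or -2 and the others vanish; these terms
    come in opposite pairs with sum [2 ^ k + (-2) ^ k] or 0. If the product is -1, the coordinates
    run once through the eight sign patterns of product 1, over which a monomial sums to 8 or 0. *)
Lemma site_sum_ge0 a b c d :
  0 <= site_sum (fun p q r s =>
    rep1 p q r s ^ a * rep2 p q r s ^ b * rep3 p q r s ^ c * rep4 p q r s ^ d).
Proof.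
  unfold site_sum, rep1, rep2, rep3, rep4; cbv zeta.
  repeat match goal with |- context [(?e / 2) ^ _] =>
    first [ replace (e / 2) with 0 by field | replace (e / 2) with 1 by field
          | replace (e / 2) with (-1) by field | replace (e / 2) with 2 by field
          | replace (e / 2) with (-2) by field ] end.
  rewrite !pow1, !pow_m2.
  assert (Ha := pow_lt 2 a ltac:(lra)). assert (Hb := pow_lt 2 b ltac:(lra)).
  assert (Hc := pow_lt 2 c ltac:(lra)). assert (Hd := pow_lt 2 d ltac:(lra)).
  (* Only the parity of each exponent, the value of [0 ^ a] (which is 1 for [a = 0]) and the
     positivity of [2 ^ a] matter, so finitely many linear cases remain. *)
  destruct (pow_0_cases a) as [-> | ->], (pow_0_cases b) as [-> | ->],
    (pow_0_cases c) as [-> | ->], (pow_0_cases d) as [-> | ->];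
  destruct (pow_m1_cases a) as [-> | ->], (pow_m1_cases b) as [-> | ->],
    (pow_m1_cases c) as [-> | ->], (pow_m1_cases d) as [-> | ->]; lra.
Qed.

Definition sum4 (n : nat) (F : (nat -> R) -> (nat -> R) -> (nat -> R) -> (nat -> R) -> R) :=
  sum_cfg n (fun w => sum_cfg n (fun x => sum_cfg n (fun y => sum_cfg n (F w x y)))).

Lemma sum4_plus n F G :
  sum4 n (fun w x y z => F w x y z + G w x y z) = sum4 n F + sum4 n G.
Proof.
  unfold sum4; rewrite <- sum_cfg_plus; apply sum_cfg_ext; intros w _.
  rewrite <- sum_cfg_plus; apply sum_cfg_ext; intros x _.
  rewrite <- sum_cfg_plus; apply sum_cfg_ext; intros y _.
  now rewrite <- sum_cfg_plus.
Qed.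

Lemma sum4_scal n c F : sum4 n (fun w x y z => c * F w x y z) = c * sum4 n F.
Proof.
  unfold sum4; rewrite <- sum_cfg_scal; apply sum_cfg_ext; intros w _.
  rewrite <- sum_cfg_scal; apply sum_cfg_ext; intros x _.
  rewrite <- sum_cfg_scal; apply sum_cfg_ext; intros y _.
  now rewrite <- sum_cfg_scal.
Qed.

Lemma sum4_cv n F G :
  (forall w x y z, Un_cv (fun N => F N w x y z) (G w x y z)) ->
  Un_cv (fun N => sum4 n (F N)) (sum4 n G).
Proof.
  intros H.
  apply (sum_cfg_cv n (fun N w =>
    sum_cfg n (fun x => sum_cfg n (fun y => sum_cfg n (F N w x y))))); intros w.
  apply (sum_cfg_cv n (fun N x => sum_cfg n (fun y => sum_cfg n (F N w x y)))); intros x.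
  apply (sum_cfg_cv n (fun N y => sum_cfg n (F N w x y))); intros y.
  apply (sum_cfg_cv n (fun N z => F N w x y z)); auto.
Qed.

Lemma sum4_fprod n (g : nat -> R -> R -> R -> R -> R) :
  sum4 n (fun w x y z => fprod n (fun i => g i (w i) (x i) (y i) (z i))) =
  fprod n (fun i => site_sum (g i)).
Proof.
  unfold sum4, site_sum.
  rewrite <- (sum_cfg_fprod n (fun i p => g i p 1 1 1 + g i p 1 1 (-1) +
    (g i p 1 (-1) 1 + g i p 1 (-1) (-1)) + (g i p (-1) 1 1 + g i p (-1) 1 (-1) +
    (g i p (-1) (-1) 1 + g i p (-1) (-1) (-1))))).
  apply sum_cfg_ext; intros w _.
  rewrite <- (sum_cfg_fprod n (fun i q => g i (w i) q 1 1 + g i (w i) q 1 (-1) +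
    (g i (w i) q (-1) 1 + g i (w i) q (-1) (-1)))).
  apply sum_cfg_ext; intros x _.
  rewrite <- (sum_cfg_fprod n (fun i r => g i (w i) (x i) r 1 + g i (w i) (x i) r (-1))).
  apply sum_cfg_ext; intros y _.
  apply (sum_cfg_fprod n (fun i s => g i (w i) (x i) (y i) s)).
Qed.

(** The cone of polynomials with nonnegative coefficients in the replica coordinates. A monomial is
    stored by its exponents at each site, so that its sum over spins factorises. *)
Inductive replica_poly (n : nat) :
    ((nat -> R) -> (nat -> R) -> (nat -> R) -> (nat -> R) -> R) -> Prop :=
| replica_mono (k : R) (a b c d : nat -> nat) : 0 <= k ->
    replica_poly n (fun w x y z => k * fprod n (fun i =>
      rep1 (w i) (x i) (y i) (z i) ^ a i * rep2 (w i) (x i) (y i) (z i) ^ b i *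
      rep3 (w i) (x i) (y i) (z i) ^ c i * rep4 (w i) (x i) (y i) (z i) ^ d i))
| replica_plus F G : replica_poly n F -> replica_poly n G ->
    replica_poly n (fun w x y z => F w x y z + G w x y z).

Lemma replica_ext n F G : (forall w x y z, F w x y z = G w x y z) ->
  replica_poly n F -> replica_poly n G.
Proof.
  intros H HF; replace G with F; auto.
  do 4 (apply functional_extensionality; intros ?); auto.
Qed.

Lemma replica_mult n F G : replica_poly n F -> replica_poly n G ->
  replica_poly n (fun w x y z => F w x y z * G w x y z).
Proof.
  intros HF HG; induction HF as [k a b c d Hk|F1 F2 _ IH1 _ IH2].
  - induction HG as [k' a' b' c' d' Hk'|G1 G2 _ IH1 _ IH2].
    + eapply replica_ext; [|apply (replica_mono n (k * k') (fun i => (a i + a' i)%nat)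
        (fun i => (b i + b' i)%nat) (fun i => (c i + c' i)%nat) (fun i => (d i + d' i)%nat));
        now apply Rmult_le_pos].
      intros w x y z; simpl.
      rewrite Rmult_assoc, (Rmult_assoc k); f_equal.
      rewrite (Rmult_comm (fprod _ _) (k' * _)), Rmult_assoc; f_equal.
      rewrite <- fprod_mult; apply fprod_ext; intros i _; rewrite !pow_add; ring.
    + eapply replica_ext; [|exact (replica_plus n _ _ IH1 IH2)].
      intros w x y z; simpl; ring.
  - eapply replica_ext; [|exact (replica_plus n _ _ IH1 IH2)].
    intros w x y z; simpl; ring.
Qed.

Lemma fprod_1 n : fprod n (fun _ => 1) = 1.
Proof. induction n as [|n IH]; simpl; [auto|rewrite IH; ring]. Qed.

Lemma fprod_pow_single n i f : (i < n)%nat ->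
  fprod n (fun j => f j ^ (if Nat.eqb j i then 1%nat else 0%nat)) = f i.
Proof.
  induction n as [|n IH]; simpl; intros H; [lia|].
  destruct (Nat.eqb_spec n i) as [->|Hn].
  - rewrite (fprod_ext i _ (fun _ => 1)).
    + rewrite fprod_1; simpl; ring.
    + intros j Hj; destruct (Nat.eqb_spec j i); [lia|auto].
  - rewrite IH by lia; simpl; ring.
Qed.

Lemma replica_const n k : 0 <= k -> replica_poly n (fun _ _ _ _ => k).
Proof.
  intros Hk; eapply replica_ext;
    [|apply (replica_mono n k (fun _ => O) (fun _ => O) (fun _ => O) (fun _ => O) Hk)].
  intros w x y z; simpl.
  rewrite (fprod_ext n _ (fun _ => 1)) by (intros; ring); rewrite fprod_1; ring.
Qed.

Lemma replica_fsum n m F : (forall i, (i < m)%nat -> replica_poly n (F i)) ->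
  replica_poly n (fun w x y z => fsum m (fun i => F i w x y z)).
Proof.
  induction m as [|m IH]; simpl; intros H.
  - apply replica_const; lra.
  - apply (replica_plus n (fun w x y z => fsum m (fun i => F i w x y z)) (F m)); auto.
Qed.

Lemma replica_scal n k F : 0 <= k -> replica_poly n F ->
  replica_poly n (fun w x y z => k * F w x y z).
Proof. intros Hk; apply (replica_mult n (fun _ _ _ _ => k)); now apply replica_const. Qed.

Lemma replica_rep1 n i : (i < n)%nat ->
  replica_poly n (fun w x y z => rep1 (w i) (x i) (y i) (z i)).
Proof.
  intros Hi; eapply replica_ext; [|apply (replica_mono n 1
    (fun j => if Nat.eqb j i then 1%nat else 0%nat) (fun _ => O) (fun _ => O) (fun _ => O)); lra].
  intros w x y z; simpl.
  rewrite <- (fprod_pow_single n i (fun i => rep1 (w i) (x i) (y i) (z i)) Hi), Rmult_1_l.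
  apply fprod_ext; intros; ring.
Qed.

Lemma replica_rep2 n i : (i < n)%nat ->
  replica_poly n (fun w x y z => rep2 (w i) (x i) (y i) (z i)).
Proof.
  intros Hi; eapply replica_ext; [|apply (replica_mono n 1
    (fun _ => O) (fun j => if Nat.eqb j i then 1%nat else 0%nat) (fun _ => O) (fun _ => O)); lra].
  intros w x y z; simpl.
  rewrite <- (fprod_pow_single n i (fun i => rep2 (w i) (x i) (y i) (z i)) Hi), Rmult_1_l.
  apply fprod_ext; intros; ring.
Qed.

Lemma replica_rep3 n i : (i < n)%nat ->
  replica_poly n (fun w x y z => rep3 (w i) (x i) (y i) (z i)).
Proof.
  intros Hi; eapply replica_ext; [|apply (replica_mono n 1
    (fun _ => O) (fun _ => O) (fun j => if Nat.eqb j i then 1%nat else 0%nat) (fun _ => O)); lra].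
  intros w x y z; simpl.
  rewrite <- (fprod_pow_single n i (fun i => rep3 (w i) (x i) (y i) (z i)) Hi), Rmult_1_l.
  apply fprod_ext; intros; ring.
Qed.

Lemma replica_rep4 n i : (i < n)%nat ->
  replica_poly n (fun w x y z => rep4 (w i) (x i) (y i) (z i)).
Proof.
  intros Hi; eapply replica_ext; [|apply (replica_mono n 1
    (fun _ => O) (fun _ => O) (fun _ => O) (fun j => if Nat.eqb j i then 1%nat else 0%nat)); lra].
  intros w x y z; simpl.
  rewrite <- (fprod_pow_single n i (fun i => rep4 (w i) (x i) (y i) (z i)) Hi), Rmult_1_l.
  apply fprod_ext; intros; ring.
Qed.

(** The sum of a monomial is a product over sites of the sums treated in [site_sum_ge0]. *)
Lemma sum4_replica_ge0 n F : replica_poly n F -> 0 <= sum4 n F.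
Proof.
  intros HF; induction HF as [k a b c d Hk|F G _ IHF _ IHG].
  - rewrite sum4_scal; apply Rmult_le_pos; auto.
    rewrite (sum4_fprod n (fun i p q r s => rep1 p q r s ^ a i * rep2 p q r s ^ b i *
      rep3 p q r s ^ c i * rep4 p q r s ^ d i)).
    apply fprod_ge0; intros; apply site_sum_ge0.
  - rewrite sum4_plus; lra.
Qed.

Lemma Un_cv_const c : Un_cv (fun _ => c) c.
Proof. intros e He; exists O; intros; rewrite Rdist_eq; auto. Qed.

(** The Taylor polynomials [E1] of the exponential have nonnegative coefficients, so every
    truncation stays in the cone; the sign passes to the limit. *)
Lemma sum4_replica_exp_ge0 n F H : replica_poly n F -> replica_poly n H ->
  0 <= sum4 n (fun w x y z => F w x y z * exp (H w x y z)).
Proof.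
  intros HF HH.
  apply (Rle_cv_lim (Un := fun _ => 0)
    (Vn := fun N => sum4 n (fun w x y z => F w x y z * E1 (H w x y z) N))).
  - intros N; apply sum4_replica_ge0, (replica_mult n F); auto.
    assert (Hpow : forall k, replica_poly n (fun w x y z => H w x y z ^ k)).
    { induction k as [|k IH]; simpl; [apply replica_const; lra|].
      now apply (replica_mult n H). }
    assert (Hterm : forall k, replica_poly n (fun w x y z => / INR (fact k) * H w x y z ^ k)).
    { intros k; apply replica_scal; auto.
      left; apply Rinv_0_lt_compat, INR_fact_lt_0. }
    unfold E1; induction N as [|N IH]; simpl; [apply (Hterm O)|].
    apply (replica_plus n (fun w x y z =>
      sum_f_R0 (fun k => / INR (fact k) * H w x y z ^ k) N)); [exact IH|apply (Hterm (S N))].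
  - apply Un_cv_const.
  - apply (sum4_cv n (fun N w x y z => F w x y z * E1 (H w x y z) N)); intros w x y z.
    apply (CV_mult (fun _ => F w x y z)); [|apply E1_cvg].
    apply Un_cv_const.
Qed.

(** * Ising expectations *)

Definition ising_mean (A : matseq) n beta B (F : (nat -> R) -> R) : R :=
  sum_cfg n (fun x => F x * ising_weight A n beta B x) / Zn A n beta B.

Lemma Zn_gt0 A n beta B : 0 < Zn A n beta B.
Proof. apply sum_cfg_gt0; intros; apply exp_pos. Qed.

Lemma mean_ext A n beta B F G : (forall x, spin x -> F x = G x) ->
  ising_mean A n beta B F = ising_mean A n beta B G.
Proof.
  intros H; unfold ising_mean; f_equal; apply sum_cfg_ext; intros; now rewrite H.
Qed.

Lemma mean_plus A n beta B F G : ising_mean A n beta B (fun x => F x + G x) =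
  ising_mean A n beta B F + ising_mean A n beta B G.
Proof.
  unfold ising_mean; rewrite <- Rdiv_plus_distr, <- sum_cfg_plus.
  f_equal; apply sum_cfg_ext; intros; ring.
Qed.

Lemma mean_scal A n beta B c F :
  ising_mean A n beta B (fun x => c * F x) = c * ising_mean A n beta B F.
Proof.
  unfold ising_mean, Rdiv; rewrite <- Rmult_assoc, <- sum_cfg_scal.
  f_equal; apply sum_cfg_ext; intros; ring.
Qed.

Lemma mean_minus A n beta B F G : ising_mean A n beta B (fun x => F x - G x) =
  ising_mean A n beta B F - ising_mean A n beta B G.
Proof.
  replace (ising_mean A n beta B F - ising_mean A n beta B G)
    with (ising_mean A n beta B F + (-1) * ising_mean A n beta B G) by ring.
  rewrite <- mean_scal, <- mean_plus; apply mean_ext; intros; ring.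
Qed.

Lemma mean_const A n beta B c : ising_mean A n beta B (fun _ => c) = c.
Proof.
  unfold ising_mean; rewrite sum_cfg_scal; fold (Zn A n beta B).
  generalize (Zn_gt0 A n beta B); intros; field; lra.
Qed.

Lemma mean_le A n beta B F G : (forall x, spin x -> F x <= G x) ->
  ising_mean A n beta B F <= ising_mean A n beta B G.
Proof.
  intros H; apply Rmult_le_compat_r; [left; apply Rinv_0_lt_compat, Zn_gt0|].
  apply sum_cfg_le; intros; apply Rmult_le_compat_r; auto; left; apply exp_pos.
Qed.

Lemma mean_abs A n beta B F :
  Rabs (ising_mean A n beta B F) <= ising_mean A n beta B (fun x => Rabs (F x)).
Proof.
  apply Rabs_le; split.
  - replace (- ising_mean A n beta B (fun x => Rabs (F x)))
      with ((-1) * ising_mean A n beta B (fun x => Rabs (F x))) by ring.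
    rewrite <- mean_scal; apply mean_le; intros x _.
    generalize (Rle_abs (- F x)); rewrite Rabs_Ropp; lra.
  - apply mean_le; intros; apply Rle_abs.
Qed.

Lemma mean_fsum A n beta B m (F : nat -> (nat -> R) -> R) :
  ising_mean A n beta B (fun x => fsum m (fun i => F i x)) =
  fsum m (fun i => ising_mean A n beta B (F i)).
Proof.
  induction m as [|m IH]; simpl; [apply mean_const|].
  now rewrite (mean_plus A n beta B (fun x => fsum m (fun i => F i x))), IH.
Qed.

(** The prefactor [c] accumulates weights and normalisations when nested expectations are unfolded
    one after another. *)
Lemma scal_mean A n beta B c F : c * ising_mean A n beta B F =
  sum_cfg n (fun x => (c * / Zn A n beta B * ising_weight A n beta B x) * F x).
Proof.
  unfold ising_mean, Rdiv.
  transitivity ((c * / Zn A n beta B) * sum_cfg n (fun x => F x * ising_weight A n beta B x));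
    [ring|rewrite <- sum_cfg_scal; apply sum_cfg_ext; intros; ring].
Qed.

(** * Expectations over four independent replicas *)

Definition mean4 A n beta B F : R :=
  ising_mean A n beta B (fun w => ising_mean A n beta B (fun x =>
  ising_mean A n beta B (fun y => ising_mean A n beta B (fun z => F w x y z)))).

(** The change of variables is orthogonal at each site, so the four quadratic energies add up to the
    same form in [rep1] to [rep4], and the four field terms add up to [2 * B] times the sum of
    [rep1]. The exponent [H] of the joint weight is therefore itself in the cone. *)
Lemma mean4_replica_ge0 (A : matseq) n beta B F :
  (forall i j, (i < n)%nat -> (j < n)%nat -> 0 <= A n i j) ->
  0 <= beta -> 0 <= B -> replica_poly n F -> 0 <= mean4 A n beta B F.
Proof.
  intros HA Hbeta HB HF.
  set (Z := Zn A n beta B). assert (HZ : 0 < Z) by apply Zn_gt0.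
  set (H := fun w x y z : nat -> R =>
    beta / 2 * fsum n (fun i => fsum n (fun j => A n i j *
      (rep1 (w i) (x i) (y i) (z i) * rep1 (w j) (x j) (y j) (z j) +
       rep2 (w i) (x i) (y i) (z i) * rep2 (w j) (x j) (y j) (z j) +
       rep3 (w i) (x i) (y i) (z i) * rep3 (w j) (x j) (y j) (z j) +
       rep4 (w i) (x i) (y i) (z i) * rep4 (w j) (x j) (y j) (z j)))) +
    B * fsum n (fun i => 2 * rep1 (w i) (x i) (y i) (z i))).
  assert (HH : replica_poly n H).
  { apply (replica_plus n (fun w x y z => beta / 2 * _)).
    - apply replica_scal; [lra|].
      apply (replica_fsum n n (fun i w x y z => _)); intros i Hi.
      apply (replica_fsum n n (fun j w x y z => _)); intros j Hj.
      apply replica_scal; [auto|].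
      apply (replica_plus n (fun w x y z => _ + _ + _));
        [apply (replica_plus n (fun w x y z => _ + _));
         [apply (replica_plus n (fun w x y z => _ * _))|]|].
      + apply (replica_mult n (fun w x y z => rep1 _ _ _ _)); now apply replica_rep1.
      + apply (replica_mult n (fun w x y z => rep2 _ _ _ _)); now apply replica_rep2.
      + apply (replica_mult n (fun w x y z => rep3 _ _ _ _)); now apply replica_rep3.
      + apply (replica_mult n (fun w x y z => rep4 _ _ _ _)); now apply replica_rep4.
    - apply replica_scal; [lra|].
      apply (replica_fsum n n (fun i w x y z => _)); intros i Hi.
      apply replica_scal; [lra|]; now apply replica_rep1. }
  assert (HW : forall w x y z, exp (H w x y z) = ising_weight A n beta B w *
    ising_weight A n beta B x * ising_weight A n beta B y * ising_weight A n beta B z).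
  { intros w x y z; unfold ising_weight; rewrite <- !exp_plus; f_equal.
    assert (E1 : forall a b c d e f g h : R, a * (b + d + f + h) + B * (c + e + g + 0) =
       a * b + B * c + (a * d + B * e) + (a * f + B * g) + (a * h + B * 0)) by (intros; ring).
    unfold H.
    rewrite <- !(fsum_scal n B), <- !(fsum_scal n (beta / 2)), <- !fsum_plus.
    apply fsum_ext; intros i _.
    rewrite <- !(fsum_scal n (beta / 2)).
    match goal with |- fsum n ?f + ?b = fsum n ?f1 + ?b1 + (fsum n ?f2 + ?b2) +
      (fsum n ?f3 + ?b3) + (fsum n ?f4 + ?b4) =>
      transitivity (fsum n (fun j => f1 j + f2 j + f3 j + f4 j) + (b1 + b2 + b3 + b4)) end.
    - f_equal; [apply fsum_ext; intros j _|]; unfold rep1, rep2, rep3, rep4; field.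
    - rewrite !fsum_plus; ring. }
  unfold mean4.
  rewrite <- (Rmult_1_l (ising_mean _ _ _ _ _)), scal_mean.
  replace (sum_cfg n _) with (/ (Z * Z * Z * Z) *
    sum4 n (fun w x y z => F w x y z * exp (H w x y z))).
  - apply Rmult_le_pos; [left; apply Rinv_0_lt_compat; repeat apply Rmult_lt_0_compat; auto|].
    now apply sum4_replica_exp_ge0.
  - rewrite <- sum4_scal; unfold sum4.
    apply sum_cfg_ext; intros w _; rewrite scal_mean.
    apply sum_cfg_ext; intros x _; rewrite scal_mean.
    apply sum_cfg_ext; intros y _; rewrite scal_mean.
    apply sum_cfg_ext; intros z _; rewrite HW; fold Z; field; lra.
Qed.

(** Centering kills the first moments, so integrating one replica out of a product of three affine
    factors leaves second and third moments. The terms in [k0] to [k3] are left over from replicas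
    integrated earlier. *)
Lemma mean_cubic A n beta B f g h a b c r s t k0 k1 k2 k3 :
  ising_mean A n beta B f = 0 -> ising_mean A n beta B g = 0 ->
  ising_mean A n beta B h = 0 ->
  ising_mean A n beta B (fun x =>
    (a + r * f x) * (b + s * g x) * (c + t * h x) +
    k1 * (a + r * f x) + k2 * (b + s * g x) + k3 * (c + t * h x) + k0) =
  a * b * c + (k1 + s * t * ising_mean A n beta B (fun x => g x * h x)) * a +
  (k2 + r * t * ising_mean A n beta B (fun x => f x * h x)) * b +
  (k3 + r * s * ising_mean A n beta B (fun x => f x * g x)) * c +
  (k0 + r * s * t * ising_mean A n beta B (fun x => f x * g x * h x)).
Proof.
  intros Hf Hg Hh.
  rewrite (mean_ext A n beta B _ (fun x =>
    (a * b * c + k1 * a + k2 * b + k3 * c + k0) + ((r * (b * c + k1)) * f x +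
    ((s * (a * c + k2)) * g x + ((t * (a * b + k3)) * h x +
    ((s * t * a) * (g x * h x) + ((r * t * b) * (f x * h x) +
    ((r * s * c) * (f x * g x) + (r * s * t) * (f x * g x * h x)))))))))
    by (intros; ring).
  rewrite (mean_plus A n beta B (fun _ => _)), mean_const.
  do 6 rewrite (mean_plus A n beta B (fun _ => _ * _)), mean_scal.
  rewrite mean_scal, Hf, Hg, Hh; ring.
Qed.

Definition ferromagnetic (A : matseq) n :=
  forall i j, (i < n)%nat -> (j < n)%nat -> 0 <= A n i j.

(* The shape of the integrand of [mean_cubic] reproduces itself when the replicas are
   integrated out one at a time. *)
Lemma mean4_cubic A n beta B f g h (a b c : R) p1 p2 p3 q1 q2 q3 r1 r2 r3 s1 s2 s3 :
  ising_mean A n beta B f = 0 -> ising_mean A n beta B g = 0 ->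
  ising_mean A n beta B h = 0 ->
  mean4 A n beta B (fun w x y z =>
    (a + p1 * f w + q1 * f x + r1 * f y + s1 * f z) *
    (b + p2 * g w + q2 * g x + r2 * g y + s2 * g z) *
    (c + p3 * h w + q3 * h x + r3 * h y + s3 * h z)) =
  a * b * c +
  (p2 * p3 + q2 * q3 + r2 * r3 + s2 * s3) * ising_mean A n beta B (fun x => g x * h x) * a +
  (p1 * p3 + q1 * q3 + r1 * r3 + s1 * s3) * ising_mean A n beta B (fun x => f x * h x) * b +
  (p1 * p2 + q1 * q2 + r1 * r2 + s1 * s2) * ising_mean A n beta B (fun x => f x * g x) * c +
  (p1 * p2 * p3 + q1 * q2 * q3 + r1 * r2 * r3 + s1 * s2 * s3) *
    ising_mean A n beta B (fun x => f x * g x * h x).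
Proof.
  intros Hf Hg Hh; unfold mean4.
  set (Cgh := ising_mean A n beta B (fun x => g x * h x)).
  set (Cfh := ising_mean A n beta B (fun x => f x * h x)).
  set (Cfg := ising_mean A n beta B (fun x => f x * g x)).
  set (K := ising_mean A n beta B (fun x => f x * g x * h x)).
  assert (Q : forall a b c r s t k0 k1 k2 k3 F, (forall x, F x =
    (a + r * f x) * (b + s * g x) * (c + t * h x) +
    k1 * (a + r * f x) + k2 * (b + s * g x) + k3 * (c + t * h x) + k0) ->
    ising_mean A n beta B F = a * b * c + (k1 + s * t * Cgh) * a +
    (k2 + r * t * Cfh) * b + (k3 + r * s * Cfg) * c + (k0 + r * s * t * K)).
  { intros; rewrite (mean_ext A n beta B F _ (fun x _ => H x)).
    now apply mean_cubic. }
  (* The rewriting goes from the outermost replica inwards; the constants supplied at each stage are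
     the total contribution of the replicas nested further inside. *)
  rewrite (Q a b c p1 p2 p3
    (q1 * q2 * q3 * K + r1 * r2 * r3 * K + s1 * s2 * s3 * K)
    (q2 * q3 * Cgh + r2 * r3 * Cgh + s2 * s3 * Cgh)
    (q1 * q3 * Cfh + r1 * r3 * Cfh + s1 * s3 * Cfh)
    (q1 * q2 * Cfg + r1 * r2 * Cfg + s1 * s2 * Cfg)); [ring|intros w].
  rewrite (Q (a + p1 * f w) (b + p2 * g w) (c + p3 * h w) q1 q2 q3
    (r1 * r2 * r3 * K + s1 * s2 * s3 * K)
    (r2 * r3 * Cgh + s2 * s3 * Cgh)
    (r1 * r3 * Cfh + s1 * s3 * Cfh)
    (r1 * r2 * Cfg + s1 * s2 * Cfg)); [ring|intros x].
  rewrite (Q (a + p1 * f w + q1 * f x) (b + p2 * g w + q2 * g x) (c + p3 * h w + q3 * h x)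
    r1 r2 r3 (s1 * s2 * s3 * K) (s2 * s3 * Cgh) (s1 * s3 * Cfh) (s1 * s2 * Cfg));
    [ring|intros y].
  rewrite (Q (a + p1 * f w + q1 * f x + r1 * f y) (b + p2 * g w + q2 * g x + r2 * g y)
    (c + p3 * h w + q3 * h x + r3 * h y) s1 s2 s3 0 0 0 0); [ring|intros z; ring].
Qed.

Lemma mean_centered A n beta B F :
  ising_mean A n beta B (fun x => F x - ising_mean A n beta B F) = 0.
Proof. rewrite mean_minus, mean_const; ring. Qed.

Lemma mean4_ext A n beta B F G :
  (forall w x y z, F w x y z = G w x y z) -> mean4 A n beta B F = mean4 A n beta B G.
Proof. intros H; unfold mean4; do 4 (apply mean_ext; intros ? _); auto. Qed.

(** * Covariances and correlation inequalities *)

Definition cov A n beta B F G : R :=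
  ising_mean A n beta B (fun x => F x * G x) -
  ising_mean A n beta B F * ising_mean A n beta B G.

Lemma cov_centered A n beta B F G :
  ising_mean A n beta B (fun x =>
    (F x - ising_mean A n beta B F) * (G x - ising_mean A n beta B G)) = cov A n beta B F G.
Proof.
  unfold cov; set (u := ising_mean A n beta B F); set (v := ising_mean A n beta B G).
  rewrite (mean_ext A n beta B _ (fun x => F x * G x + ((- v) * F x + ((- u) * G x + u * v))))
    by (intros; ring).
  rewrite mean_plus, (mean_plus A n beta B (fun x => _ * _)), mean_scal,
    (mean_plus A n beta B (fun x => _ * _)), mean_scal, mean_const.
  fold u v; ring.
Qed.

(** The four replicas have the same law, so [rep1] at site [i] has expectation [2 * u]. The two
    other factors required by [mean4_cubic] are set to 1. *)
Lemma griffiths_first (A : matseq) n beta B i : ferromagnetic A n -> 0 <= beta -> 0 <= B ->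
  (i < n)%nat -> 0 <= ising_mean A n beta B (fun x => x i).
Proof.
  intros HA Hbeta HB Hi.
  assert (P := mean4_replica_ge0 A n beta B _ HA Hbeta HB (replica_rep1 n i Hi)).
  set (u := ising_mean A n beta B (fun x => x i)).
  rewrite (mean4_ext A n beta B _ (fun w x y z =>
    (2 * u + / 2 * (w i - u) + / 2 * (x i - u) + / 2 * (y i - u) + / 2 * (z i - u)) *
    (1 + 0 * 0 + 0 * 0 + 0 * 0 + 0 * 0) * (1 + 0 * 0 + 0 * 0 + 0 * 0 + 0 * 0))) in P
    by (intros; unfold rep1; field).
  rewrite (mean4_cubic A n beta B (fun x => x i - u) (fun _ => 0) (fun _ => 0)) in P
    by (apply mean_const || apply (mean_centered A n beta B (fun x => x i))).
  rewrite !Rmult_0_r in P; lra.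
Qed.

(** In [rep2] the means cancel, and in the product of [rep2] at [i] and [j] each replica contributes
    a quarter of the covariance. *)
Lemma griffiths_second (A : matseq) n beta B i j : ferromagnetic A n -> 0 <= beta -> 0 <= B ->
  (i < n)%nat -> (j < n)%nat -> 0 <= cov A n beta B (fun x => x i) (fun x => x j).
Proof.
  intros HA Hbeta HB Hi Hj.
  assert (P := mean4_replica_ge0 A n beta B _ HA Hbeta HB
    (replica_mult n _ _ (replica_rep2 n i Hi) (replica_rep2 n j Hj))).
  rewrite <- cov_centered.
  set (u := ising_mean A n beta B (fun x => x i)).
  set (v := ising_mean A n beta B (fun x => x j)).
  rewrite (mean4_ext A n beta B _ (fun w x y z =>
    (0 + / 2 * (w i - u) + / 2 * (x i - u) + - / 2 * (y i - u) + - / 2 * (z i - u)) *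
    (0 + / 2 * (w j - v) + / 2 * (x j - v) + - / 2 * (y j - v) + - / 2 * (z j - v)) *
    (1 + 0 * 0 + 0 * 0 + 0 * 0 + 0 * 0))) in P
    by (intros; unfold rep2; field).
  rewrite (mean4_cubic A n beta B (fun x => x i - u) (fun x => x j - v) (fun _ => 0)) in P
    by (apply mean_const || apply (mean_centered A n beta B (fun x => x _))).
  lra.
Qed.

Definition magnetization n (x : nat -> R) : R := fsum n x.

(** The nonnegative quantity is the expectation of [rep2] at [i] times the sum of [rep3] times the
    sum of [rep4]. The means cancel in all three factors, so only the third central moment survives;
    each replica gives it the coefficient -1/8, in total -1/2. *)
Lemma ghs_inequality (A : matseq) n beta B i : ferromagnetic A n -> 0 <= beta -> 0 <= B ->
  (i < n)%nat ->
  let u := ising_mean A n beta B (fun x => x i) in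
  let m := ising_mean A n beta B (magnetization n) in
  ising_mean A n beta B (fun x =>
    (x i - u) * (magnetization n x - m) * (magnetization n x - m)) <= 0.
Proof.
  intros HA Hbeta HB Hi u m.
  assert (P := mean4_replica_ge0 A n beta B _ HA Hbeta HB
    (replica_mult n _ _ (replica_mult n _ _ (replica_rep2 n i Hi)
      (replica_fsum n n _ (fun k Hk => replica_rep3 n k Hk)))
      (replica_fsum n n _ (fun k Hk => replica_rep4 n k Hk)))).
  assert (E3 : forall w x y z, fsum n (fun k => rep3 (w k) (x k) (y k) (z k)) =
    0 + / 2 * (magnetization n w - m) + - / 2 * (magnetization n x - m) +
    / 2 * (magnetization n y - m) + - / 2 * (magnetization n z - m)).
  { intros; unfold magnetization.
    transitivity (fsum n (fun k => / 2 * w k + - / 2 * x k + / 2 * y k + - / 2 * z k)).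
    - apply fsum_ext; intros; unfold rep3; field.
    - rewrite !fsum_plus, !fsum_scal; ring. }
  assert (E4 : forall w x y z, fsum n (fun k => rep4 (w k) (x k) (y k) (z k)) =
    0 + - / 2 * (magnetization n w - m) + / 2 * (magnetization n x - m) +
    / 2 * (magnetization n y - m) + - / 2 * (magnetization n z - m)).
  { intros; unfold magnetization.
    transitivity (fsum n (fun k => - / 2 * w k + / 2 * x k + / 2 * y k + - / 2 * z k)).
    - apply fsum_ext; intros; unfold rep4; field.
    - rewrite !fsum_plus, !fsum_scal; ring. }
  rewrite (mean4_ext A n beta B _ (fun w x y z =>
    (0 + / 2 * (w i - u) + / 2 * (x i - u) + - / 2 * (y i - u) + - / 2 * (z i - u)) *
    (0 + / 2 * (magnetization n w - m) + - / 2 * (magnetization n x - m) +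
      / 2 * (magnetization n y - m) + - / 2 * (magnetization n z - m)) *
    (0 + - / 2 * (magnetization n w - m) + / 2 * (magnetization n x - m) +
      / 2 * (magnetization n y - m) + - / 2 * (magnetization n z - m)))) in P
    by (intros; rewrite E3, E4; unfold rep2; field).
  rewrite (mean4_cubic A n beta B (fun x => x i - u) (fun x => magnetization n x - m)
    (fun x => magnetization n x - m)) in P
    by (apply (mean_centered A n beta B (fun x => x _)) ||
        apply (mean_centered A n beta B (magnetization n))).
  lra.
Qed.

(** * Dependence on the magnetic field *)

(** Differentiating the weight in the field multiplies it by the magnetization; the quotient rule
    subtracts the product of the means. *)
Lemma derivable_ising_mean A n beta B F :
  derivable_pt_lim (fun b => ising_mean A n beta b F) B
    (cov A n beta B F (magnetization n)).
Proof.
  assert (HW : forall x, derivable_pt_lim (fun b => ising_weight A n beta b x) B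
    (ising_weight A n beta B x * magnetization n x)).
  { intros x; unfold ising_weight.
    apply (derivable_pt_lim_comp (fun b => _ + b * _) exp);
      [|apply derivable_pt_lim_exp].
    replace (magnetization n x) with (0 + (1 * magnetization n x + B * 0)) by ring.
    apply (derivable_pt_lim_plus (fun _ => _) (fun b => b * _));
      [apply derivable_pt_lim_const|].
    apply (derivable_pt_lim_mult id (fun _ => _));
      [apply derivable_pt_lim_id|apply derivable_pt_lim_const]. }
  assert (HZ := Zn_gt0 A n beta B).
  set (N1 := sum_cfg n (fun x => F x * (ising_weight A n beta B x * magnetization n x))).
  set (Z1 := sum_cfg n (fun x => ising_weight A n beta B x * magnetization n x)).
  replace (cov A n beta B F (magnetization n)) with
    ((N1 * Zn A n beta B - Z1 * sum_cfg n (fun x => F x * ising_weight A n beta B x)) /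
     Rsqr (Zn A n beta B)).
  - apply (derivable_pt_lim_div
      (fun b => sum_cfg n (fun x => F x * ising_weight A n beta b x)) (fun b => Zn A n beta b));
      [| |lra].
    + apply (sum_cfg_derivable n (fun b x => F x * ising_weight A n beta b x)); intros x.
      apply (derivable_pt_lim_scal (fun b => ising_weight A n beta b x)), HW.
    + apply (sum_cfg_derivable n (fun b x => ising_weight A n beta b x)), HW.
  - unfold cov, ising_mean.
    replace (sum_cfg n (fun x => F x * magnetization n x * _)) with N1
      by (apply sum_cfg_ext; intros; ring).
    replace (sum_cfg n (fun x => magnetization n x * _)) with Z1
      by (apply sum_cfg_ext; intros; ring).
    unfold Rsqr; field; lra.
Qed.

(** This is the second derivative of the mean of [F] in the field; for [F] a single spin, its sign
    is given by [ghs_inequality]. *)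
Lemma derivable_cov_magnetization A n beta B F :
  let u := ising_mean A n beta B F in
  let m := ising_mean A n beta B (magnetization n) in
  derivable_pt_lim (fun b => cov A n beta b F (magnetization n)) B
    (ising_mean A n beta B (fun x =>
      (F x - u) * (magnetization n x - m) * (magnetization n x - m))).
Proof.
  intros u m; set (M := magnetization n) in *.
  replace (ising_mean A n beta B (fun x => (F x - u) * (M x - m) * (M x - m))) with
    (cov A n beta B (fun x => F x * M x) M -
      (cov A n beta B F M * m + u * cov A n beta B M M)).
  - apply (derivable_pt_lim_minus (fun b => ising_mean A n beta b (fun x => F x * M x))
      (fun b => ising_mean A n beta b F * ising_mean A n beta b M));
      [apply derivable_ising_mean|].
    apply (derivable_pt_lim_mult (fun b => ising_mean A n beta b F));
      apply derivable_ising_mean.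
  - rewrite (mean_ext A n beta B (fun x => (F x - u) * (M x - m) * (M x - m))
      (fun x => F x * M x * M x + ((- 2 * m) * (F x * M x) + ((m * m) * F x +
        ((- u) * (M x * M x) + ((2 * u * m) * M x + (- u * m * m))))))) by (intros; ring).
    rewrite mean_plus.
    do 4 rewrite (mean_plus A n beta B (fun x => _ * _)), mean_scal.
    rewrite mean_const; unfold cov; fold u m; ring.
Qed.

(* By the GHS inequality the magnetization is concave in the field, so its slope at [B]
   is at most the slope [1 / B] of a chord from [0]. *)
Lemma susceptibility_bound (A : matseq) n beta B i : ferromagnetic A n -> 0 <= beta ->
  0 < B -> (i < n)%nat ->
  fsum n (fun j => cov A n beta B (fun x => x i) (fun x => x j)) <= / B.
Proof.
  intros HA Hbeta HB Hi.
  set (chi := fun b => cov A n beta b (fun x => x i) (magnetization n)).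
  replace (fsum n _) with (chi B).
  2:{ unfold chi, cov; change (magnetization n) with (fun x => fsum n (fun j => x j)).
      rewrite fsum_minus, fsum_scal, mean_fsum; f_equal.
      rewrite <- (mean_fsum A n beta B n (fun j x => x i * x j)).
      apply mean_ext; intros x _; now rewrite fsum_scal. }
  assert (Hchi : forall b, 0 <= b -> b < B -> chi B <= chi b).
  { intros b Hb HbB.
    destruct (MVT_cor2 chi _ b B HbB (fun c _ =>
      derivable_cov_magnetization A n beta c (fun x => x i))) as (c & Hc & Hcb).
    assert (G := ghs_inequality A n beta c i HA Hbeta ltac:(lra) Hi); cbv zeta in G, Hc.
    set (k := ising_mean A n beta c _) in G.
    change (chi B - chi b = k * (B - b)) in Hc. nra. }
  (* Between the fields 0 and [B] the mean spin grows by [chi c * B]. It starts nonnegative by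
     Griffiths and ends at most 1, so [chi c * B <= 1], and [chi B <= chi c]. *)
  destruct (MVT_cor2 (fun b => ising_mean A n beta b (fun x => x i)) chi 0 B HB
    (fun c _ => derivable_ising_mean A n beta c (fun x => x i))) as (c & Hc & Hc0).
  assert (H0 := griffiths_first A n beta 0 i HA Hbeta ltac:(lra) Hi).
  assert (H1 : ising_mean A n beta B (fun x => x i) <= 1).
  { rewrite <- (mean_const A n beta B 1); apply mean_le; intros x Hx.
    destruct (Hx i); lra. }
  assert (H2 := Hchi c ltac:(lra) ltac:(lra)).
  apply Rmult_le_reg_r with B; auto; rewrite Rinv_l by lra. nra.
Qed.

(** * Local fields *)

Lemma fsum_delta n j c f : (j < n)%nat ->
  fsum n (fun i => (if Nat.eqb i j then c else 0) * f i) = c * f j.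
Proof.
  induction n as [|n IH]; simpl; intros H; [lia|].
  destruct (Nat.eqb_spec n j) as [->|Hn].
  - rewrite (fsum_ext j _ (fun _ => 0)).
    + rewrite fsum_const; ring.
    + intros i Hi; destruct (Nat.eqb_spec i j); [lia|ring].
  - rewrite IH by lia; ring.
Qed.

Definition symmetric0 (A : matseq) n :=
  (forall i j, (i < n)%nat -> (j < n)%nat -> A n i j = A n j i) /\
  (forall i, (i < n)%nat -> A n i i = 0).

Lemma mloc_upd A n i j x s :
  (j < n)%nat -> mloc A n i (upd x j s) = mloc A n i x + (s - x j) * A n i j.
Proof.
  intros Hj; unfold mloc; rewrite <- (fsum_delta n j (s - x j) (fun k => A n i k) Hj).
  rewrite <- fsum_plus; apply fsum_ext; intros k _; unfold upd.
  destruct (Nat.eqb_spec k j) as [->|]; ring.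
Qed.

(** The zero diagonal removes the term quadratic in the change of [x j]. By symmetry row and column
    [j] contribute equally, which cancels the factor 1/2 in the energy. *)
Lemma ising_weight_upd A n beta B x j s : symmetric0 A n -> (j < n)%nat ->
  ising_weight A n beta B (upd x j s) =
  ising_weight A n beta B x * exp ((s - x j) * (beta * mloc A n j x + B)).
Proof.
  intros [HS HD] Hj; unfold ising_weight; rewrite <- exp_plus; f_equal.
  set (d := s - x j).
  assert (HU : forall k, upd x j s k = x k + (if Nat.eqb k j then d else 0) * 1).
  { intros k; unfold upd, d; destruct (Nat.eqb_spec k j) as [->|]; ring. }
  rewrite (fsum_ext n (fun i => upd x j s i) _ (fun k _ => HU k)).
  rewrite fsum_plus, fsum_delta by auto.
  replace (fsum n (fun i => fsum n (fun k => A n i k * upd x j s i * upd x j s k))) with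
    (fsum n (fun i => fsum n (fun k => A n i k * x i * x k)) + 2 * d * mloc A n j x);
    [change (fsum n (fun i => x i)) with (fsum n x); field|].
  transitivity (fsum n (fun i => upd x j s i * mloc A n i (upd x j s))).
  2:{ apply fsum_ext; intros i _; unfold mloc; rewrite <- fsum_scal.
      apply fsum_ext; intros; ring. }
  transitivity (fsum n (fun i => x i * mloc A n i x + d * (A n j i * x i) +
    (if Nat.eqb i j then d else 0) * (mloc A n i x + d * A n i j))).
  - rewrite fsum_plus, fsum_delta, fsum_plus, fsum_scal, HD by auto.
    change (fsum n (fun i => A n j i * x i)) with (mloc A n j x).
    replace (fsum n (fun i => fsum n (fun k => A n i k * x i * x k)))
      with (fsum n (fun i => x i * mloc A n i x)); [ring|].
    apply fsum_ext; intros i _; unfold mloc; rewrite <- fsum_scal.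
    apply fsum_ext; intros; ring.
  - apply fsum_ext; intros i Hi; rewrite mloc_upd, HU by auto; fold d.
    rewrite (HS j i) by auto; ring.
Qed.

(* The right-hand side averages the conditional mean of [x j] given the other spins. *)
Lemma mean_spin A n beta B j : symmetric0 A n -> (j < n)%nat ->
  ising_mean A n beta B (fun x => x j) =
  ising_mean A n beta B (fun x => tanh (beta * mloc A n j x + B)).
Proof.
  intros HA Hj; apply Rminus_diag_uniq; rewrite <- mean_minus.
  unfold ising_mean; apply Rmult_eq_0_compat_r.
  (* [S] is unchanged by the flip at [j], so [S + S] sums each term together with its flipped
     partner, and every such pair cancels. *)
  set (S := sum_cfg n _). assert (HS : S + S = 0); [|lra].
  unfold S at 2; rewrite (sum_cfg_flip n j) by auto; unfold S; rewrite <- sum_cfg_plus.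
  replace 0 with (sum_cfg n (fun _ => 0 * 0)) by (rewrite sum_cfg_scal; ring).
  apply sum_cfg_ext; intros x Hx.
  rewrite ising_weight_upd, mloc_upd, upd_same by auto.
  (* With zero diagonal, the local field at [j] does not see the flip. *)
  destruct HA as [_ HD]; rewrite (HD j Hj).
  replace (beta * (mloc A n j x + (- x j - x j) * 0) + B)
    with (beta * mloc A n j x + B) by ring.
  set (h := beta * mloc A n j x + B); set (W := ising_weight A n beta B x).
  assert (Hc := cosh_gt0 h).
  assert (E : exp h * exp (- h) = 1) by (rewrite <- exp_plus, Rplus_opp_r; apply exp_0).
  assert (Ht : tanh h * (exp h + exp (- h)) = exp h - exp (- h)).
  { unfold tanh, sinh in *; unfold cosh in *; field; lra. }
  assert (P1 := exp_pos h); assert (P2 := exp_pos (- h)).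
  destruct (Hx j) as [-> | ->].
  - replace ((- (1) - 1) * h) with (- h + - h) by ring; rewrite exp_plus.
    transitivity (W * exp (- h) * ((1 - tanh h) * exp h - (1 + tanh h) * exp (- h)) +
      W * (1 - tanh h) * (1 - exp h * exp (- h))); [ring|].
    rewrite E; replace ((1 - tanh h) * exp h - (1 + tanh h) * exp (- h))
      with (exp h - exp (- h) - tanh h * (exp h + exp (- h))) by ring.
    rewrite Ht; ring.
  - replace ((- (-1) - -1) * h) with (h + h) by ring; rewrite exp_plus.
    transitivity (W * exp h * ((1 - tanh h) * exp h - (1 + tanh h) * exp (- h)) +
      W * (-1 - tanh h) * (1 - exp h * exp (- h))); [ring|].
    rewrite E; replace ((1 - tanh h) * exp h - (1 + tanh h) * exp (- h))
      with (exp h - exp (- h) - tanh h * (exp h + exp (- h))) by ring.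
    rewrite Ht; ring.
Qed.

Lemma cov_sym A n beta B F G : cov A n beta B F G = cov A n beta B G F.
Proof.
  unfold cov; rewrite (Rmult_comm (ising_mean _ _ _ _ F)); f_equal.
  apply mean_ext; intros; ring.
Qed.

(* Schur's test: the covariance matrix has row sums, hence operator norm, at most [1 / B]. *)
Lemma local_field_variance (A : matseq) n beta B : ferromagnetic A n -> 0 <= beta -> 0 < B ->
  fsum n (fun i => ising_mean A n beta B
    (fun x => (mloc A n i x - ising_mean A n beta B (mloc A n i)) ^ 2))
  <= / B * fsum n (fun i => fsum n (fun j => A n i j ^ 2)).
Proof.
  intros HA Hbeta HB; rewrite <- fsum_scal; apply fsum_le; intros i Hi.
  set (C := fun j k => cov A n beta B (fun x => x j) (fun x => x k)).
  set (u := fun j => ising_mean A n beta B (fun x => x j)).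
  transitivity (fsum n (fun j => fsum n (fun k => A n i j * A n i k * C j k))).
  - right.
    rewrite (mean_ext A n beta B _ (fun x => fsum n (fun j => fsum n (fun k =>
      A n i j * A n i k * ((x j - u j) * (x k - u k)))))).
    + rewrite mean_fsum; apply fsum_ext; intros j _.
      rewrite mean_fsum; apply fsum_ext; intros k _.
      rewrite mean_scal; f_equal; apply (cov_centered A n beta B (fun x => x j) (fun x => x k)).
    + intros x _.
      replace (mloc A n i x - ising_mean A n beta B (mloc A n i)) with
        (fsum n (fun j => A n i j * (x j - u j))).
      * simpl; rewrite Rmult_1_r, fsum_mult; apply fsum_ext; intros j _.
        apply fsum_ext; intros; ring.
      * unfold mloc at 2; rewrite mean_fsum; unfold mloc; rewrite <- fsum_minus.
        apply fsum_ext; intros j _; rewrite mean_scal; fold (u j); ring.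
  (* The product of [A n i j] and [A n i k] is at most half the sum of their squares, and
     [C j k >= 0] by Griffiths. By symmetry of the covariance the two halves agree, leaving its row
     sums. *)
  - transitivity (fsum n (fun j => fsum n (fun k => / 2 * (A n i j ^ 2 * C j k))) +
      fsum n (fun j => fsum n (fun k => / 2 * (A n i k ^ 2 * C j k)))).
    { rewrite <- fsum_plus; apply fsum_le; intros j Hj.
      rewrite <- fsum_plus; apply fsum_le; intros k Hk.
      assert (H := griffiths_second A n beta B j k HA Hbeta ltac:(lra) Hj Hk); fold (C j k) in H.
      assert (0 <= (A n i j - A n i k) ^ 2 * C j k)
        by (apply Rmult_le_pos; auto; apply pow2_ge_0).
      lra. }
    rewrite (fsum_swap n n (fun j k => / 2 * (A n i k ^ 2 * C j k))).
    rewrite <- fsum_plus, <- fsum_scal; apply fsum_le; intros j Hj.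
    rewrite <- fsum_plus.
    transitivity (A n i j ^ 2 * fsum n (fun k => C j k)).
    + right; rewrite <- fsum_scal; apply fsum_ext; intros k _.
      unfold C; rewrite (cov_sym A n beta B (fun x => x k)); field.
    + rewrite (Rmult_comm (/ B)); apply Rmult_le_compat_l; [apply pow2_ge_0|].
      now apply susceptibility_bound.
Qed.

(** * The deterministic mean field equation *)

(** Replaces Cauchy-Schwarz: an average of absolute values is controlled by an average of squares,
    at the cost of a free parameter [eta] sent to 0 last. *)
Lemma abs_le_sq v eta : 0 < eta -> Rabs v <= eta + / eta * v ^ 2.
Proof.
  intros He; rewrite <- (pow2_abs v); set (a := Rabs v); assert (0 <= a) by apply Rabs_pos.
  apply Rmult_le_reg_l with eta; auto.
  replace (eta * (eta + / eta * a ^ 2)) with (eta * eta + a ^ 2) by (field; lra).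
  nra.
Qed.

(** The empirical mean minimises the average squared deviation; [c] will be the fixed point [t]. *)
Lemma Tn_le A n x c : (0 < n)%nat ->
  Tn A n x <= / INR n * fsum n (fun i => (mloc A n i x - c) ^ 2).
Proof.
  intros Hn; assert (HN : 0 < INR n) by now apply lt_0_INR.
  assert (E : forall c, fsum n (fun i => (mloc A n i x - c) ^ 2) =
    fsum n (fun i => mloc A n i x ^ 2) - 2 * c * (INR n * mbar A n x) + INR n * c ^ 2).
  { intros d; unfold mbar.
    replace (INR n * (/ INR n * _)) with (fsum n (fun i => mloc A n i x)) by (field; lra).
    rewrite <- fsum_const, <- fsum_scal, <- fsum_minus, <- fsum_plus.
    apply fsum_ext; intros; ring. }
  unfold Tn; apply Rmult_le_compat_l; [left; now apply Rinv_0_lt_compat|].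
  rewrite !E; assert (0 <= INR n * (mbar A n x - c) ^ 2)
    by (apply Rmult_le_pos; [lra|apply pow2_ge_0]).
  nra.
Qed.

(* In l1 norm the row sums of [A] enter one by one, so that only their average deviation
   from [r] matters; the operator norm of [A] may well exceed [r]. *)
Lemma mean_field_stability (A : matseq) n beta B g r t (u : nat -> R) :
  symmetric0 A n -> ferromagnetic A n -> 0 < beta -> 0 < B -> 0 <= g -> 0 <= r ->
  (forall i, (i < n)%nat -> rowsum A n i <= g) ->
  (forall i, (i < n)%nat -> 0 <= u i) ->
  0 <= t <= g -> t = r * tanh (beta * t + B) ->
  B / (beta * g + B) * fsum n (fun i => Rabs (mloc A n i u - t)) <=
  g * fsum n (fun j => Rabs (u j - tanh (beta * mloc A n j u + B))) +
  3 * fsum n (fun i => Rabs (rowsum A n i - r)).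
Proof.
  intros [HS _] HA Hbeta HB Hg Hr HR Hu Ht Et.
  set (mu := fun i => mloc A n i u). set (f := fun s => tanh (beta * s + B)).
  assert (Hmu : forall i, (i < n)%nat -> 0 <= mu i).
  { intros i Hi; apply fsum_ge0; intros j Hj; apply Rmult_le_pos; auto. }
  (* Using [t = r * f t], the difference [mu i - t] splits into the defect of [u = f mu], the
     distance from [f mu] to [f t], and the row sum error times [f t]. *)
  assert (Hpt : forall i, (i < n)%nat -> Rabs (mu i - t) <=
    fsum n (fun j => A n i j * Rabs (u j - f (mu j))) +
    fsum n (fun j => A n i j * Rabs (f (mu j) - f t)) + Rabs (rowsum A n i - r)).
  { intros i Hi.
    replace (mu i - t) with (fsum n (fun j => A n i j * (u j - f (mu j))) +
      fsum n (fun j => A n i j * (f (mu j) - f t)) + (rowsum A n i - r) * f t).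
    - eapply Rle_trans; [apply Rabs_triang|apply Rplus_le_compat].
      + eapply Rle_trans; [apply Rabs_triang|apply Rplus_le_compat];
          (eapply Rle_trans; [apply fsum_abs|]); apply fsum_le; intros j Hj;
          rewrite Rabs_mult, (Rabs_pos_eq (A n i j)) by auto; lra.
      + rewrite Rabs_mult; rewrite <- (Rmult_1_r (Rabs (_ - _))) at 2.
        apply Rmult_le_compat_l; [apply Rabs_pos|].
        apply Rabs_le, tanh_bound.
    - assert (Et' : t = r * f t) by exact Et.
      set (ft := f t) in *.
      replace (mu i) with (fsum n (fun j => A n i j * (u j - f (mu j))) +
        fsum n (fun j => A n i j * (f (mu j) - ft)) + ft * rowsum A n i).
      + rewrite Et'; ring.
      + unfold rowsum; rewrite <- fsum_scal, <- !fsum_plus.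
        apply fsum_ext; intros; ring. }
  (* Summing over [i] produces column sums, which symmetry turns into row sums. *)
  assert (Hsum : forall v, fsum n (fun i => fsum n (fun j => A n i j * v j)) =
    fsum n (fun j => rowsum A n j * v j)).
  { intros v; rewrite fsum_swap; apply fsum_ext; intros j Hj.
    unfold rowsum; rewrite Rmult_comm, <- fsum_scal; apply fsum_ext; intros i Hi.
    rewrite (HS i j) by auto; ring. }
  assert (Htot := fsum_le n _ _ Hpt); cbv beta in Htot.
  rewrite !fsum_plus, !Hsum in Htot.
  assert (H1 : fsum n (fun j => rowsum A n j * Rabs (u j - f (mu j))) <=
    g * fsum n (fun j => Rabs (u j - f (mu j)))).
  { rewrite <- fsum_scal; apply fsum_le; intros j Hj.
    apply Rmult_le_compat_r; auto; apply Rabs_pos. }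
  (* Write the row sum as [r] plus an error. The part with [r] contracts; the error meets a
     difference of [tanh] values, at most 2, which with the error term in [Hpt] makes the constant
     3. *)
  assert (H2 : fsum n (fun j => rowsum A n j * Rabs (f (mu j) - f t)) <=
    (1 - B / (beta * g + B)) * fsum n (fun j => Rabs (mu j - t)) +
    2 * fsum n (fun j => Rabs (rowsum A n j - r))).
  { rewrite <- !fsum_scal, <- fsum_plus; apply fsum_le; intros j Hj.
    assert (K := mean_field_contraction beta B r g t (mu j) Hbeta HB Hr Ht (Hmu j Hj) Et).
    fold (f (mu j)) (f t) in K.
    assert (Hf : Rabs (f (mu j) - f t) <= 2).
    { apply Rabs_le; unfold f; generalize (tanh_bound (beta * mu j + B))
        (tanh_bound (beta * t + B)); lra. }
    assert (P := Rle_abs (rowsum A n j - r)).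
    assert (P1 := Rabs_pos (rowsum A n j - r)). assert (P2 := Rabs_pos (f (mu j) - f t)).
    assert ((rowsum A n j - r) * Rabs (f (mu j) - f t) <= Rabs (rowsum A n j - r) * 2)
      by (apply Rle_trans with (Rabs (rowsum A n j - r) * Rabs (f (mu j) - f t));
          [now apply Rmult_le_compat_r|now apply Rmult_le_compat_l]).
    lra. }
  change (fsum n (fun i => Rabs (mloc A n i u - t))) with (fsum n (fun i => Rabs (mu i - t))).
  change (fsum n (fun j => Rabs (u j - tanh (beta * mloc A n j u + B))))
    with (fsum n (fun j => Rabs (u j - f (mu j)))).
  lra.
Qed.

(** Fluctuations of the local fields around [mu] are controlled by the variance bound, and the
    distance from [mu] to [t] by stability of the mean field equation. The bound vanishes if first
    [a] and [d], then [eta], tend to 0. *)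
Lemma mean_Tn_bound (A : matseq) n beta B g eta : (0 < n)%nat ->
  symmetric0 A n -> ferromagnetic A n -> 0 < beta -> 0 < B -> 0 <= g -> 0 < eta ->
  (forall i, (i < n)%nat -> rowsum A n i <= g) ->
  let a := / INR n * fsum n (fun i => fsum n (fun j => A n i j ^ 2)) in
  let d := / INR n * fsum n (fun i => (rowsum A n i - rowsum_avg A n) ^ 2) in
  ising_mean A n beta B (Tn A n) <=
  2 * (/ B * a) + 2 * g * ((beta * g + B) / B *
    (g * (beta * (eta + / eta * (/ B * a))) + 3 * (eta + / eta * d))).
Proof.
  intros Hn HA0 HA Hbeta HB Hg Heta HR a d.
  assert (HN : 0 < INR n) by now apply lt_0_INR.
  set (r := rowsum_avg A n).
  assert (HR0 : forall i, (i < n)%nat -> 0 <= rowsum A n i)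
    by (intros i Hi; apply fsum_ge0; auto).
  assert (HNi : 0 < / INR n) by now apply Rinv_0_lt_compat.
  assert (Hr : 0 <= r <= g).
  { unfold r, rowsum_avg; split.
    - apply Rmult_le_pos; [lra|now apply fsum_ge0].
    - replace g with (/ INR n * fsum n (fun _ => g)) by (rewrite fsum_const; field; lra).
      apply Rmult_le_compat_l; [lra|now apply fsum_le]. }
  destruct (mean_field_fixpoint beta B r) as (t & Ht & Et); try lra.
  set (E := ising_mean A n beta B).
  set (u := fun j => E (fun x => x j)). set (mu := fun i => mloc A n i u).
  assert (Hmu : forall i, E (mloc A n i) = mu i).
  { intros i; unfold E, mloc; rewrite mean_fsum; apply fsum_ext; intros j _.
    apply mean_scal. }
  set (V := fun i => E (fun x => (mloc A n i x - mu i) ^ 2)).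
  assert (HV : fsum n V <= / B * (INR n * a)).
  { unfold a; rewrite <- (Rmult_assoc (INR n)), Rinv_r, Rmult_1_l by lra.
    eapply Rle_trans; [|apply (local_field_variance A n beta B HA); lra].
    right; apply fsum_ext; intros i _; unfold V; now rewrite <- Hmu. }
  assert (Hu : forall j, (j < n)%nat -> 0 <= u j)
    by (intros; apply griffiths_first; auto; lra).
  assert (Hu1 : forall j, u j <= 1).
  { intros j; unfold u, E; rewrite <- (mean_const A n beta B 1).
    apply mean_le; intros x Hx; destruct (Hx j); lra. }
  assert (Hmu0 : forall i, (i < n)%nat -> 0 <= mu i <= g).
  { intros i Hi; split.
    - apply fsum_ge0; intros; apply Rmult_le_pos; auto.
    - eapply Rle_trans; [|apply (HR i Hi)]; apply fsum_le; intros j Hj.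
      rewrite <- (Rmult_1_r (A n i j)) at 2; apply Rmult_le_compat_l; auto. }
  (* By [mean_spin], [u j] is the mean of [tanh] at the random local field; the Lipschitz bound
     leaves a mean absolute deviation, which [abs_le_sq] turns into the variance [V j]. *)
  assert (Hfix : forall j, (j < n)%nat -> Rabs (u j - tanh (beta * mu j + B)) <=
    beta * (eta + / eta * V j)).
  { intros j Hj; unfold u, E; rewrite mean_spin by auto.
    rewrite <- (mean_const A n beta B (tanh (beta * mu j + B))) at 1.
    rewrite <- mean_minus.
    eapply Rle_trans; [apply mean_abs|].
    unfold V, E; rewrite <- (mean_const A n beta B eta) at 1.
    rewrite <- !mean_scal, <- mean_plus, <- mean_scal; apply mean_le; intros x _.
    eapply Rle_trans; [apply tanh_lipschitz|].
    replace (beta * mloc A n j x + B - (beta * mu j + B)) with (beta * (mloc A n j x - mu j))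
      by ring.
    rewrite Rabs_mult, (Rabs_pos_eq beta) by lra.
    apply Rmult_le_compat_l; [lra|now apply abs_le_sq]. }
  assert (Hl1 : fsum n (fun i => Rabs (mu i - t)) <= INR n * ((beta * g + B) / B *
    (g * (beta * (eta + / eta * (/ B * a))) + 3 * (eta + / eta * d)))).
  { assert (S := mean_field_stability A n beta B g r t u HA0 HA Hbeta HB Hg
      (proj1 Hr) HR Hu ltac:(lra) Et).
    fold mu in S.
    assert (S1 : fsum n (fun j => Rabs (u j - tanh (beta * mloc A n j u + B))) <=
      INR n * (beta * (eta + / eta * (/ B * a)))).
    { eapply Rle_trans; [apply fsum_le, Hfix|].
      rewrite fsum_scal, fsum_plus, fsum_const, fsum_scal.
      replace (INR n * (beta * (eta + / eta * (/ B * a)))) with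
        (beta * (INR n * eta + / eta * (/ B * (INR n * a)))) by ring.
      apply Rmult_le_compat_l; [lra|]; apply Rplus_le_compat_l.
      apply Rmult_le_compat_l; auto; left; now apply Rinv_0_lt_compat. }
    assert (S2 : fsum n (fun i => Rabs (rowsum A n i - r)) <= INR n * (eta + / eta * d)).
    { eapply Rle_trans; [apply fsum_le; intros i _; apply (abs_le_sq _ eta Heta)|].
      rewrite fsum_plus, fsum_const, fsum_scal; unfold d; fold r; right; field; lra. }
    assert (Hbg : 0 < beta * g + B) by nra.
    assert (Hc : 0 < (beta * g + B) / B) by now apply Rdiv_lt_0_compat.
    apply Rmult_le_compat_l with (r := (beta * g + B) / B) in S; [|lra].
    rewrite <- Rmult_assoc in S.
    replace ((beta * g + B) / B * (B / (beta * g + B))) with 1 in S by (field; lra).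
    rewrite Rmult_1_l in S; eapply Rle_trans; [exact S|].
    apply Rmult_le_compat_l with (r := g) in S1; auto.
    replace (INR n * _) with ((beta * g + B) / B *
      (g * (INR n * (beta * (eta + / eta * (/ B * a)))) + 3 * (INR n * (eta + / eta * d))))
      by ring.
    apply Rmult_le_compat_l; lra. }
  (* The squared distance of a local field from [t] is at most twice its squared deviation from
     [mu i] plus twice [(mu i - t) ^ 2]; the latter square is at most [g * Rabs (mu i - t)], as
     [mu i] and [t] both lie in [[0, g]]. *)
  apply Rle_trans with (/ INR n * (2 * fsum n V + 2 * g * fsum n (fun i => Rabs (mu i - t)))).
  - unfold V; rewrite <- !fsum_scal, <- fsum_plus.
    rewrite <- (fsum_scal n (/ INR n)).
    apply Rle_trans with (E (fun x => / INR n * fsum n (fun i => (mloc A n i x - t) ^ 2))).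
    + apply mean_le; intros x _; now apply Tn_le.
    + unfold E; rewrite mean_scal, mean_fsum, <- fsum_scal; apply fsum_le; intros i Hi.
      apply Rmult_le_compat_l; [lra|].
      rewrite <- (mean_const A n beta B (2 * g * _)), <- mean_scal, <- mean_plus.
      apply mean_le; intros x _.
      assert (Rabs (mu i - t) * Rabs (mu i - t) <= Rabs (mu i - t) * g).
      { apply Rmult_le_compat_l; [apply Rabs_pos|].
        apply Rabs_le; generalize (Hmu0 i Hi); lra. }
      assert (Q := pow2_abs (mu i - t)).
      assert (0 <= (mloc A n i x - mu i - (mu i - t)) ^ 2) by apply pow2_ge_0.
      nra.
  - rewrite Rmult_comm; apply Rmult_le_reg_r with (INR n); auto.
    rewrite Rmult_assoc, Rinv_l, Rmult_1_r by lra.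
    apply Rmult_le_compat_l with (r := 2 * g) in Hl1; [|lra].
    lra.
Qed.

(** * From the expectation to the probability; symmetry in the field *)

Lemma Tn_ge0 A n x : 0 <= Tn A n x.
Proof.
  apply Rmult_le_pos.
  (* For [n = 0] the factor is [/ 0], whose value is 0. *)
  - destruct n; [simpl; rewrite Rinv_0; lra|].
    left; apply Rinv_0_lt_compat, lt_0_INR; lia.
  - apply fsum_ge0; intros; apply pow2_ge_0.
Qed.

Lemma prob_Tn_gt_ge0 A n beta B eps : 0 <= prob_Tn_gt A n beta B eps.
Proof.
  apply Rmult_le_pos; [|left; apply Rinv_0_lt_compat, Zn_gt0].
  apply sum_cfg_ge0; intros x _; destruct Rlt_dec; [left; apply exp_pos|lra].
Qed.

Lemma prob_Tn_gt_markov A n beta B eps : 0 < eps ->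
  prob_Tn_gt A n beta B eps <= / eps * ising_mean A n beta B (Tn A n).
Proof.
  intros He; rewrite <- mean_scal.
  apply Rmult_le_compat_r; [left; apply Rinv_0_lt_compat, Zn_gt0|].
  apply sum_cfg_le; intros x _.
  assert (W := exp_pos (beta / 2 * fsum n (fun i => fsum n (fun j => A n i j * x i * x j))
       + B * fsum n (fun i => x i))); fold (ising_weight A n beta B x) in W.
  assert (HT := Tn_ge0 A n x); assert (Hi := Rinv_0_lt_compat _ He).
  rewrite Rabs_pos_eq by auto; destruct Rlt_dec as [H|H].
  - rewrite <- (Rmult_1_l (ising_weight A n beta B x)) at 1.
    apply Rmult_le_compat_r; [lra|].
    rewrite <- (Rinv_l eps) by lra; apply Rmult_le_compat_l; lra.
  - apply Rmult_le_pos; [apply Rmult_le_pos|]; lra.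
Qed.

(** The global flip preserves the quadratic energy and reverses the field term. The local fields and
    their average change sign together, so [Tn] is invariant. *)
Lemma prob_Tn_gt_opp A n beta B eps :
  prob_Tn_gt A n beta (- B) eps = prob_Tn_gt A n beta B eps.
Proof.
  assert (HW : forall x, ising_weight A n beta (- B) (fun i => - x i) =
    ising_weight A n beta B x).
  { intros x; unfold ising_weight; f_equal; f_equal.
    - f_equal; apply fsum_ext; intros i _; apply fsum_ext; intros; ring.
    - rewrite <- !fsum_scal; apply fsum_ext; intros; ring. }
  assert (HT : forall x, Tn A n (fun i => - x i) = Tn A n x).
  { intros x; assert (Hm : forall i, mloc A n i (fun i => - x i) = (-1) * mloc A n i x).
    { intros i; unfold mloc; rewrite <- fsum_scal; apply fsum_ext; intros; ring. }
    assert (Hb : mbar A n (fun i => - x i) = (-1) * mbar A n x).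
    { unfold mbar; rewrite (fsum_ext n _ _ (fun i _ => Hm i)), fsum_scal; ring. }
    unfold Tn; f_equal; apply fsum_ext; intros i _; rewrite Hm, Hb; ring. }
  (* [LW] and [LT] supply the locality that [sum_cfg_neg] requires. *)
  assert (LW : forall b x y, (forall i, (i < n)%nat -> x i = y i) ->
    ising_weight A n beta b x = ising_weight A n beta b y).
  { intros b x y H; unfold ising_weight; f_equal; f_equal.
    - f_equal; apply fsum_ext; intros i Hi; apply fsum_ext; intros j Hj.
      now rewrite (H i Hi), (H j Hj).
    - f_equal; now apply fsum_ext. }
  assert (LT : forall x y, (forall i, (i < n)%nat -> x i = y i) -> Tn A n x = Tn A n y).
  { intros x y H; assert (Hm : forall i, mloc A n i x = mloc A n i y).
    { intros i; apply fsum_ext; intros j Hj; now rewrite H. }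
    unfold Tn, mbar; rewrite (fsum_ext n _ _ (fun i _ => Hm i)).
    f_equal; apply fsum_ext; intros i _; now rewrite Hm. }
  unfold prob_Tn_gt, ising_prob, Zn; f_equal;
    rewrite (sum_cfg_neg n).
  - apply sum_cfg_ext; intros x _; now rewrite HW, HT.
  - intros x y H; now rewrite (LW _ x y H), (LT x y H).
  - apply sum_cfg_ext; intros x _; apply HW.
  - intros x y H; now apply LW.
Qed.

Theorem theorem3 (A : matseq)
  (Hsym : forall n i j, (i < n)%nat -> (j < n)%nat -> A n i j = A n j i)
  (Hnn : forall n i j, (i < n)%nat -> (j < n)%nat -> 0 <= A n i j)
  (Hdiag : forall n i, (i < n)%nat -> A n i i = 0)
  (HC1 : exists gamma : R, forall n i, (i < n)%nat -> rowsum A n i <= gamma)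
  (Hmf : Un_cv (fun n => / INR n * fsum n (fun i => fsum n (fun j => (A n i j) ^ 2))) 0)
  (Hreg : Un_cv (fun n => / INR n * fsum n (fun i => (rowsum A n i - rowsum_avg A n) ^ 2)) 0) :
  forall beta B : R, 0 < beta -> B <> 0 ->
  forall eps : R, 0 < eps ->
  Un_cv (fun n => prob_Tn_gt A n beta B eps) 0.
Proof.
  intros beta B Hbeta HB eps Heps.
  assert (Hpos : forall b, 0 < b -> Un_cv (fun n => prob_Tn_gt A n beta b eps) 0).
  { clear B HB; intros B HB; destruct HC1 as [gamma HR].
    set (g := Rmax gamma 0). assert (Hg : 0 <= g) by apply Rmax_r.
    set (c := (beta * g + B) / B).
    assert (Hc : 0 < c) by (unfold c; apply Rdiv_lt_0_compat; nra).
    set (bound := fun eta a d => / eps * (2 * (/ B * a) + 2 * g * (c *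
      (g * (beta * (eta + / eta * (/ B * a))) + 3 * (eta + / eta * d))))).
    (* [K * eta] is the limit of the bound as its arguments [a] and [d] tend to 0. *)
    set (K := / eps * (2 * g * (c * (g * beta + 3)))).
    assert (HK : 0 <= K).
    { unfold K; assert (Hi := Rinv_0_lt_compat _ Heps).
      assert (0 <= g * beta) by (apply Rmult_le_pos; lra).
      clearbody c g; repeat apply Rmult_le_pos; lra. }
    intros e He.
    (* This choice gives [K * eta < e]; the added 1 keeps the denominator positive when [K = 0]. *)
    set (eta := e / (2 * (K + 1))).
    assert (Heta : 0 < eta) by (unfold eta; apply Rdiv_lt_0_compat; lra).
    assert (HKe : K * eta < e).
    { unfold eta; apply Rmult_lt_reg_r with (2 * (K + 1)); [lra|].
      replace (K * (e / (2 * (K + 1))) * (2 * (K + 1))) with (K * e) by (field; lra); nra. }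
    assert (Hcv : Un_cv (fun n => bound eta
      (/ INR n * fsum n (fun i => fsum n (fun j => (A n i j) ^ 2)))
      (/ INR n * fsum n (fun i => (rowsum A n i - rowsum_avg A n) ^ 2))) (K * eta)).
    { replace (K * eta) with (bound eta 0 0) by (unfold bound, K; ring).
      unfold bound.
      repeat first [exact Hmf | exact Hreg | apply Un_cv_const
        | apply (CV_plus (fun _ => _) (fun _ => _)) | apply (CV_mult (fun _ => _) (fun _ => _))]. }
    destruct (Hcv (e - K * eta)) as [N HN]; [lra|].
    (* The successor ensures [0 < n], as [mean_Tn_bound] requires. *)
    exists (S N); intros n Hn.
    unfold Rdist; rewrite Rminus_0_r, Rabs_pos_eq by apply prob_Tn_gt_ge0.
    eapply Rle_lt_trans; [now apply prob_Tn_gt_markov|].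
    specialize (HN n ltac:(lia)); unfold Rdist in HN; apply Rabs_def2 in HN.
    eapply Rle_lt_trans; [|apply (Rplus_lt_reg_r (- (K * eta))), (proj1 HN)].
    apply Rmult_le_compat_l; [left; now apply Rinv_0_lt_compat|].
    apply (mean_Tn_bound A n beta B g eta ltac:(lia) (conj (Hsym n) (Hdiag n)) (Hnn n)
      Hbeta HB Hg Heta).
    intros i Hi; eapply Rle_trans; [now apply HR|apply Rmax_l]. }
  destruct (Rtotal_order B 0) as [H|[H|H]]; [|tauto|auto].
  apply (Un_cv_ext (fun n => prob_Tn_gt A n beta (- B) eps)).
  - intros n; apply prob_Tn_gt_opp.
  - apply Hpos; lra.
Qed.
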